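(* For any $n\ge1$, $$C_n(-1,q)=\sum_{\pi\in\mathfrak{S}_n(321)}(-1)^{\mathsf{exc}\,\pi}q^{\mathsf{inv}\,\pi-\mathsf{exc}\,\pi}=\begin{cases}0,& n\text{ even},\\ (-q)^{(n-1)/2}C_{(n-1)/2}(q^2),& n\text{ odd},\end{cases}$$ and $$\sum_{\pi\in\mathfrak{D}_n(321)}(-1)^{\mathsf{exc}\,\pi}q^{\mathsf{inv}\,\pi}=\begin{cases}(-q)^{n/2}C_{n/2}(q^2),& n\text{ even},\\ 0,& n\text{ odd}.\end{cases}$$
   Context: $C_n(t,q)$ is defined by $\sum_{n\ge0}C_n(t,q)z^n=1/(1-c_1z/(1-c_2z/(1-c_3z/\cdots)))$ with $c_{2k-1}=q^{k-1}$, $c_{2k}=tq^{k-1}$; Carlitz's $q$-Catalan numbers are $C_n(q):=C_n(q,q^2)$. $\mathfrak{S}_n(321)$: permutations of $[n]$ avoiding $321$; $\mathfrak{D}_n(321)$: those among them with no fixed point. $\mathsf{exc}\,\pi=\#\{i:\pi(i)>i\}$, $\mathsf{inv}\,\pi=\#\{i<j:\pi(i)>\pi(j)\}$. *)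

(* Defs.v *)
From HB Require Import structures.
From mathcomp Require Import all_boot all_order all_algebra all_fingroup.
Set Implicit Arguments. Unset Strict Implicit. Unset Printing Implicit Defensive.
Import GRing.Theory.
Local Open Scope ring_scope.

(* Continued-fraction coefficients c_j (j >= 1):
   c_{2k-1} = q^(k-1), c_{2k} = t q^(k-1). *)
Definition cfc (R : comNzRingType) (t q : R) (j : nat) : R :=
  if odd j then q ^+ j./2 else t * q ^+ (j./2).-1.

(* G_j(z) = 1/(1 - c_j z/(1 - c_{j+1} z/ ...)) satisfies
   G_j = 1 + c_j z G_{j+1} G_j, hence its coefficients g_n(j) satisfy
   g_0(j) = 1, g_{n+1}(j) = sum_{k<=n} c_j g_k(j+1) g_{n-k}(j).
   cf_table t q n = [:: g_0; ...; g_n]. *)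
Fixpoint cf_table (R : comNzRingType) (t q : R) (n : nat) : seq (nat -> R) :=
  match n with
  | 0 => [:: fun _ => 1]
  | m.+1 =>
      let tb := cf_table t q m in
      rcons tb (fun j => \sum_(k < m.+1)
                  cfc t q j * nth (fun _ => 0) tb k j.+1
                            * nth (fun _ => 0) tb (m - k)%N j)
  end.

(* C_n(t,q) = [z^n] G_1(z). *)
Definition Ctq (R : comNzRingType) (t q : R) (n : nat) : R :=
  nth (fun _ => 0) (cf_table t q n) n 1%N.

Definition Carlitz (R : comNzRingType) (q : R) (n : nat) : R := Ctq q (q ^+ 2) n.

Definition avoids321 (n : nat) (s : 'S_n) : bool :=
  [forall i : 'I_n, forall j : 'I_n, forall k : 'I_n,
     ~~ [&& (i < j)%N, (j < k)%N, (s i > s j)%N & (s j > s k)%N]].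

Definition derangement (n : nat) (s : 'S_n) : bool := [forall i : 'I_n, s i != i].

Definition excnum (n : nat) (s : 'S_n) : nat := #|[set i : 'I_n | (i < s i)%N]|.

Definition invnum (n : nat) (s : 'S_n) : nat :=
  #|[set p : 'I_n * 'I_n | (p.1 < p.2)%N && (s p.2 < s p.1)%N]|.

(* Main.v *)
Require Import Defs.
From HB Require Import structures.
From mathcomp Require Import all_boot all_order all_algebra all_fingroup.
From mathcomp Require Import zify ring.
Set Implicit Arguments. Unset Strict Implicit. Unset Printing Implicit Defensive.
Import GRing.Theory.
Local Open Scope ring_scope.

(** A 321-avoiding permutation [s] is increasing on its excedance positions and
    on the remaining ones, hence is determined by its sets of excedance
    positions and of excedance values.  Reading both indicators from left to
    right gives a Motzkin path with two kinds of level steps off the axis, whose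
    height after step [i] is #{a <= i < s a}; the inversion number is the sum of
    the heights, and fixed points are the level steps on the axis.  Level steps
    off the axis cancel for the derangement weights, leaving Dyck paths with
    up-down weights [-q^(2h+1)], which is Carlitz' continued fraction in [q^2].
    The full sum is the even contraction of the fraction defining [Ctq]; at
    [t = -1] its odd contraction has no level steps and the same weights
    [-q^(2h+1)]. *)

(** * Weighted Motzkin and Dyck paths, and their contractions *)

Section WeightedPaths.
Variable R : comNzRingType.
Implicit Types u l d c : nat -> R.

(* Total weight of the [n]-step Motzkin paths from height [h] down to [0]; up
   and level steps are weighted by their starting height, down steps by their
   final height. *)
Fixpoint motzkin u l d (n h : nat) : R :=
  if n is m.+1 then
    u h * motzkin u l d m h.+1 + l h * motzkin u l d m h
    + (if h is k.+1 then d k * motzkin u l d m k else 0)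
  else (h == 0%N)%:R.

Definition dyck c := motzkin c (fun=> 0) (fun=> 1).

Lemma dyck0 c h : dyck c 0 h = (h == 0%N)%:R.
Proof. by []. Qed.

Lemma dyckS0 c n : dyck c n.+1 0 = c 0%N * dyck c n 1.
Proof. by rewrite /dyck /= mul0r !addr0. Qed.

Lemma dyckSS c n h :
  dyck c n.+1 h.+1 = c h.+1 * dyck c n h.+2 + dyck c n h.
Proof. by rewrite /dyck /= mul0r addr0 mul1r. Qed.

Lemma eq_motzkin u l d u' l' d' :
  u =1 u' -> l =1 l' -> d =1 d' -> motzkin u l d =2 motzkin u' l' d'.
Proof.
move=> eu el ed; elim=> [|n IHn] h //=.
by rewrite eu el !IHn; case: h => [//|h]; rewrite ed IHn.
Qed.

(** Steps from [k.+1] down to [k] outnumber the up steps from [k] by one if [k < h] and equal them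
    otherwise, so [d k] can be moved onto the up steps, leaving one factor for each [k < h]. *)
Lemma motzkin_normalise u l d n h :
  motzkin u l d n h =
  (\prod_(i < h) d i) * motzkin (fun k => u k * d k) l (fun=> 1) n h.
Proof.
elim: n h => [|n IHn] h.
  by case: h => [|h] /=; rewrite ?mulr0 // big_ord0 mul1r.
rewrite /= !IHn big_ord_recr /=.
case: h => [|h]; first by rewrite !big_ord0; ring.
by rewrite IHn !big_ord_recr /=; ring.
Qed.

(** Steps are taken in pairs between even heights: two equal steps become one step, a peak or a
    valley becomes a level step. On the axis there is no valley. *)
Lemma dyck_even c n h :
  dyck c n.*2 h.*2 =
  motzkin (fun k => c k.*2 * c k.*2.+1)
          (fun k => c k.*2 + (if k is j.+1 then c j.*2.+1 else 0))
          (fun=> 1) n h.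
Proof.
elim: n h => [|n IHn] [|h] //.
  rewrite /= -(IHn 0%N) -(IHn 1%N) doubleS dyckS0 dyckSS.
  by rewrite -[(0%N).*2]/0%N -[(1%N).*2]/2%N; ring.
rewrite /= -!IHn !doubleS !dyckSS; ring.
Qed.

(** The pairs now join odd heights, before a forced last step from [1] to [0]. A valley is possible
    even at the lowest level, hence the uniform level weight. *)
Lemma dyck_odd c n h :
  dyck c n.*2.+1 h.*2.+1 =
  motzkin (fun k => c k.*2.+1 * c k.*2.+2)
          (fun k => c k.*2 + c k.*2.+1) (fun=> 1) n h.
Proof.
elim: n h => [|n IHn] h.
  by rewrite dyckSS dyck0 mulr0 add0r dyck0; case: h.
rewrite /= -!IHn !doubleS; case: h => [|h].
  by rewrite dyckSS dyckSS dyckS0 -[(0%N).*2]/0%N; ring.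
by rewrite -IHn !doubleS !dyckSS; ring.
Qed.

Lemma dyck_gt c n h : (n < h)%N -> dyck c n h = 0.
Proof.
elim: n h => [|n IHn] [|h] // ltnh.
by rewrite dyckSS !IHn ?mulr0 ?addr0 //; lia.
Qed.

Lemma dyck_parity c n h : odd (n + h) -> dyck c n h = 0.
Proof.
elim: n h => [|n IHn] [|h] // o.
  by rewrite dyckS0 IHn ?mulr0 //; lia.
by rewrite dyckSS !IHn ?mulr0 ?addr0 //; lia.
Qed.

(** A path of this length has exactly [m] up steps. *)
Lemma dyck_scale x c m h :
  dyck (fun k => x * c k) (m.*2 + h) h = x ^+ m * dyck c (m.*2 + h) h.
Proof.
move En: (m.*2 + h)%N => n; elim: n m h En => [|n IHn] m h En.
  have -> : m = 0%N by lia.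
  by rewrite expr0 mul1r.
case: m En => [|m] En.
  case: h En => [|h] En; first by lia.
  rewrite !dyckSS !(@dyck_gt _ n h.+2) ?(IHn 0%N h); [|lia..].
  by rewrite !mulr0 !add0r.
case: h En => [|h] En.
  by rewrite !dyckS0 (IHn m 1%N) ?exprS; [ring | lia].
by rewrite !dyckSS (IHn m h.+2) ?(IHn m.+1 h) ?exprS; [ring | lia..].
Qed.

End WeightedPaths.

(** * Cauchy products of sequences *)

Section Convolution.
Variable R : comNzRingType.
Implicit Types a b c : nat -> R.

Definition conv a b n : R := \sum_(k < n.+1) a k * b (n - k)%N.

Lemma conv_polyE a b N n : (n <= N)%N ->
  conv a b n = ((\poly_(i < N.+1) a i) * (\poly_(i < N.+1) b i))`_n.
Proof.
move=> lenN; rewrite coefM; apply: eq_bigr => k _.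
by rewrite !coef_poly !ifT //; have := ltn_ord k; lia.
Qed.

(** Truncation to degree [n] does not change the coefficient, so associativity comes from the
    polynomial ring. *)
Lemma convA a b c n : conv a (conv b c) n = conv (conv a b) c n.
Proof.
pose P (f : nat -> R) := \poly_(i < n.+1) f i.
transitivity ((P a * (P b * P c))`_n).
  rewrite coefM; apply: eq_bigr => k _.
  by rewrite coef_poly ltn_ord (@conv_polyE _ _ n) ?leq_subr.
rewrite mulrA coefM; apply: eq_bigr => k _.
rewrite coef_poly ifT; last by have := ltn_ord k; lia.
by rewrite (@conv_polyE _ _ n) // -ltnS.
Qed.

Lemma convSl a b n :
  conv a b n.+1 = a 0%N * b n.+1 + conv (fun k => a k.+1) b n.
Proof. by rewrite /conv big_ord_recl. Qed.

End Convolution.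

(** * The continued fraction as a sum over Dyck paths *)

Section ContinuedFraction.
Variables (R : comNzRingType) (t q : R).

Definition cfg (j n : nat) : R := nth (fun=> 0) (cf_table t q n) n j.

Lemma size_cf_table n : size (cf_table t q n) = n.+1.
Proof. by elim: n => //= n IHn; rewrite size_rcons IHn. Qed.

Lemma nth_cf_table n k j : (k <= n)%N ->
  nth (fun=> 0) (cf_table t q n) k j = cfg j k.
Proof.
elim: n => [|n IHn]; first by case: k.
rewrite leq_eqVlt => /predU1P[->//|ltkn].
by rewrite /= nth_rcons size_cf_table ltkn IHn.
Qed.

Lemma cfg0 j : cfg j 0 = 1.
Proof. by []. Qed.

Lemma cfgS j n : cfg j n.+1 = cfc t q j * conv (cfg j.+1) (cfg j) n.
Proof.
rewrite {1}/cfg /= nth_rcons size_cf_table ltnn eqxx /conv big_distrr /=.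
apply: eq_bigr => k _; rewrite -mulrA.
by rewrite !nth_cf_table ?leq_subr // -ltnS.
Qed.

(* Coefficients of [G_{h+1} ... G_2 G_1], the generating function of the Dyck
   paths from height [h] to [0] by number of up steps. *)
Fixpoint cfg_prod (h : nat) : nat -> R :=
  if h is k.+1 then conv (cfg h.+1) (cfg_prod k) else cfg 1.

Lemma cfg_prod0 h : cfg_prod h 0 = 1.
Proof.
by elim: h => //= h IHh; rewrite /conv big_ord1 subn0 IHh cfg0 mulr1.
Qed.

(** This is G_{h+2} = 1 + c_{h+2} z G_{h+3} G_{h+2}, multiplied by G_{h+1} ... G_1. *)
Lemma cfg_prodSS h n :
  cfg_prod h.+1 n.+1 = cfg_prod h n.+1 + cfc t q h.+2 * cfg_prod h.+2 n.
Proof.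
rewrite /= convSl cfg0 mul1r convA; congr (_ + _).
by rewrite /conv big_distrr /=; apply: eq_bigr => k _; rewrite cfgS !mulrA.
Qed.

(** Both sides obey the first-step recursion, by [cfgS] on the axis and by [cfg_prodSS] above it.
    Here [n] counts the up steps. *)
Lemma dyck_cfg n h : dyck (fun k => cfc t q k.+1) (n.*2 + h) h = cfg_prod h n.
Proof.
move EN: (n.*2 + h)%N => N; elim: N n h EN => [|N IHN] n h EN.
  by have [-> ->] : n = 0%N /\ h = 0%N by lia.
case: h EN => [|h] EN.
  case: n EN => [|n] EN; first by lia.
  by rewrite dyckS0 (IHN n) /= ?cfgS //; lia.
rewrite dyckSS; case: n EN => [|n] EN.
  rewrite dyck_gt ?mulr0 ?add0r ?(IHN 0%N) ?cfg_prod0 //; lia.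
by rewrite cfg_prodSS (IHN n) ?(IHN n.+1) 1?addrC //; lia.
Qed.

Lemma Ctq_dyck n : Ctq t q n = dyck (fun k => cfc t q k.+1) n.*2 0.
Proof. by have := dyck_cfg n 0; rewrite addn0. Qed.

Lemma cfc_odd h : cfc t q h.*2.+1 = q ^+ h.
Proof. by rewrite /cfc /= odd_double uphalf_double. Qed.

Lemma cfc_even h : cfc t q h.*2.+2 = t * q ^+ h.
Proof. by rewrite /cfc /= odd_double /= doubleK. Qed.

End ContinuedFraction.

(** * Path models of the Catalan polynomials *)

Section CatalanEvaluations.
Variables (R : comNzRingType) (q : R).

(** Even contraction gives the up-down weight c_{2h+1} c_{2h+2} = t q^(2h), shared here between the
    up and the down step so as to match [step_weight]. *)
Lemma Ctq_motzkin t n :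
  Ctq t q n =
  motzkin (fun h => t * q ^+ h)
          (fun h => if h is k.+1 then t * q ^+ k + q ^+ h else 1)
          (fun h => q ^+ h) n 0.
Proof.
rewrite Ctq_dyck motzkin_normalise big_ord0 mul1r -[0%N in LHS]/(0%N.*2).
rewrite dyck_even; apply: eq_motzkin => // h.
  by rewrite cfc_odd cfc_even; ring.
by case: h => [|h]; rewrite ?cfc_odd ?cfc_even ?addr0 // addrC.
Qed.

(** With t = q and base q^2 the two parities merge into c_{k+1} = q^k. *)
Lemma Carlitz_dyck n : Carlitz q n = dyck (fun k => q ^+ k) n.*2 0.
Proof.
rewrite /Carlitz Ctq_dyck; apply: eq_motzkin => // k.
rewrite -(odd_double_half k); case: (odd k) => /=.
  by rewrite add1n cfc_even -exprM mul2n exprS.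
by rewrite add0n cfc_odd -exprM mul2n.
Qed.

End CatalanEvaluations.

(** * Signed Dyck paths and the value at t = -1 *)

Section SignedDyck.
Variables (R : comNzRingType) (q : R).

Lemma dyck_signed n :
  dyck (fun k => - q ^+ k.*2.+1) n 0 =
  if odd n then 0 else (- q) ^+ n./2 * Carlitz (q ^+ 2) n./2.
Proof.
case: ifP => on; first by rewrite dyck_parity // addn0.
rewrite Carlitz_dyck -{1}(odd_double_half n) on add0n.
have := dyck_scale (- q) (fun k => (q ^+ 2) ^+ k) n./2 0.
rewrite addn0 => <-; apply: eq_motzkin => // k.
by rewrite -exprM mul2n mulNr exprS.
Qed.

(** The first step has weight c_1 = 1. In the odd contraction of the rest, the level weight q^h + t
    q^h vanishes at t = -1. *)
Lemma Ctq_Nm1 n : (0 < n)%N ->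
  Ctq (-1) q n = if odd n then (- q) ^+ n.-1./2 * Carlitz (q ^+ 2) n.-1./2 else 0.
Proof.
case: n => // n _; rewrite Ctq_dyck doubleS dyckS0.
rewrite -[1%N in LHS]/(0%N.*2.+1) dyck_odd cfc_odd mul1r /= if_neg -dyck_signed.
apply: eq_motzkin => // h; last by rewrite cfc_odd cfc_even; ring.
by rewrite cfc_even -doubleS cfc_odd mulN1r mulNr -exprD; congr (- q ^+ _); lia.
Qed.

End SignedDyck.

(** * Words encoding Motzkin paths with two kinds of level steps *)

Lemma sum_tupleS (V : nmodType) (T : finType) n (F : n.+1.-tuple T -> V) :
  \sum_w F w = \sum_x \sum_(w : n.-tuple T) F (cons_tuple x w).
Proof.
rewrite pair_big /= (reindex (fun p : T * n.-tuple T => cons_tuple p.1 p.2)) //.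
exists (fun w => (thead w, behead_tuple w)) => [[x w] _ | w _] /=.
  by congr pair; apply: val_inj.
by rewrite [RHS]tuple_eta; apply: val_inj.
Qed.

Section Words.
Variables (R : comNzRingType) (y t q : R).

(* A letter [(a, b)] stands for an up step [(1, 0)], a down step [(0, 1)] or one
   of two kinds of level steps; truncation only occurs for a down step at
   height [0], whose weight vanishes. *)
Definition next_height (h : nat) (x : bool * bool) : nat := (h + x.1 - x.2)%N.

Definition height_at (w : seq (bool * bool)) i := foldl next_height 0%N (take i w).

(** The exponent of [q] is the height after the step, less one for the letters with first entry
    [true], which [t] counts; [y] marks level steps on the axis. *)
Definition step_weight (x : bool * bool) (h : nat) : R :=
  match x, h with
  | (true, false), _ => t * q ^+ h
  | (true, true), k.+1 => t * q ^+ k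
  | (false, true), k.+1 => q ^+ k
  | (_, true), 0 => 0
  | (false, false), 0 => y
  | (false, false), _.+1 => q ^+ h
  end.

Fixpoint word_weight (h : nat) (w : seq (bool * bool)) : R :=
  if w is x :: w' then step_weight x h * word_weight (next_height h x) w'
  else (h == 0%N)%:R.

Lemma word_weight_prod h w :
  word_weight h w =
  (\prod_(i < size w)
     step_weight (nth (false, false) w i) (foldl next_height h (take i w)))
  * (foldl next_height h w == 0%N)%:R.
Proof.
elim: w h => [|x w IHw] h /=; first by rewrite big_ord0 mul1r.
by rewrite IHw big_ord_recl /= -!mulrA.
Qed.

Lemma sum_word_weight n h :
  \sum_(w : n.-tuple (bool * bool)) word_weight h w =
  motzkin (fun k => t * q ^+ k)
          (fun k => if k is j.+1 then t * q ^+ j + q ^+ k else y)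
          (fun k => q ^+ k) n h.
Proof.
elim: n h => [|n IHn] h.
  rewrite (eq_bigr (fun=> (h == 0%N)%:R)); last by move=> w _; rewrite tuple0.
  by rewrite sumr_const card_tuple expn0.
rewrite sum_tupleS /=.
under eq_bigr => x _ do rewrite -big_distrr /= IHn.
set M := motzkin _ _ _.
transitivity (\sum_a \sum_b step_weight (a, b) h * M n (next_height h (a, b))).
  by rewrite pair_bigA; apply: eq_bigr => -[].
rewrite !big_bool /next_height /= !addn0 !subn0 addn1.
rewrite /M; case: h => [|h] /=; first by ring.
by rewrite !subn1 /=; ring.
Qed.

(** These turn out to be the words of the 321-avoiding permutations; all others have weight [0]. *)
Definition valid_word n (w : n.-tuple (bool * bool)) : bool :=
  [forall i : 'I_n, (tnth w i).2 ==> (0 < height_at w i)%N] && (height_at w n == 0%N).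

Lemma word_weight0 n (w : n.-tuple (bool * bool)) :
  ~~ valid_word w -> word_weight 0 w = 0.
Proof.
rewrite word_weight_prod negb_and => /orP[/forallPn[i]|]; last first.
  by rewrite /height_at take_oversize ?size_tuple // => /negPf->; rewrite mulr0.
rewrite negb_imply -eqn0Ngt => /andP[wi2 /eqP h0].
have lti : (i < size w)%N by rewrite size_tuple.
rewrite (bigD1 (Ordinal lti)) //= -/(height_at w i) h0 -tnth_nth.
by case: (tnth w i) wi2 => [[] []] //= _; rewrite !mul0r.
Qed.

End Words.

Lemma height_atS n (w : n.-tuple (bool * bool)) (i : 'I_n) :
  height_at w i.+1 = next_height (height_at w i) (tnth w i).
Proof.
rewrite /height_at (take_nth (false, false)) ?size_tuple // foldl_rcons.
by rewrite -tnth_nth.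
Qed.

(** * Ranks within a set of positions or values *)

Section Count.
Variable n : nat.
Implicit Types P : pred 'I_n.

(** At an element of [P] this is its rank in [P], starting from [0]. *)
Definition count_below P (m : nat) := #|[set v : 'I_n | P v && (v < m)%N]|.

Lemma count_below0 P : count_below P 0 = 0%N.
Proof. by apply: eq_card0 => v; rewrite inE ltn0 andbF. Qed.

Lemma count_belowS P (v : 'I_n) :
  count_below P v.+1 = (count_below P v + P v)%N.
Proof.
rewrite /count_below (cardsD1 v) inE ltnSn andbT addnC; congr (_ + _)%N.
apply: eq_card => u; rewrite !inE -val_eqE /=.
by case: (P u); lia.
Qed.

Lemma leq_count_below P m k : (m <= k)%N -> (count_below P m <= count_below P k)%N.
Proof.
move=> lemk; apply/subset_leq_card/subsetP => v; rewrite !inE => /andP[-> /=].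
by move/leq_trans; apply.
Qed.

Lemma ltn_count_below P (u : 'I_n) m :
  P u -> (u < m)%N -> (count_below P u < count_below P m)%N.
Proof.
move=> Pu ltum; apply: leq_trans (leq_count_below P ltum).
by rewrite count_belowS Pu addn1.
Qed.

Lemma count_below_inj P (u v : 'I_n) :
  P u -> P v -> count_below P u = count_below P v -> u = v.
Proof.
move=> Pu Pv e; apply: val_inj => /=; case: (ltngtP u v) => // lt.
  by have := ltn_count_below Pu lt; rewrite e ltnn.
by have := ltn_count_below Pv lt; rewrite e ltnn.
Qed.

Lemma eq_count_below P P' m : P =1 P' -> count_below P m = count_below P' m.
Proof. by move=> e; apply: eq_card => v; rewrite !inE e. Qed.

Lemma count_belowT m : (m <= n)%N -> count_below predT m = m.
Proof.
elim: m => [|m IHm] ltmn; first by rewrite count_below0.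
by rewrite (count_belowS _ (Ordinal ltmn)) IHm ?addn1 // ltnW.
Qed.

Lemma count_belowC P m : (m <= n)%N ->
  (count_below P m + count_below (predC P) m)%N = m.
Proof.
elim: m => [|m IHm] ltmn; first by rewrite !count_below0.
rewrite !(count_belowS _ (Ordinal ltmn)) /= addnACA IHm; last exact: ltnW.
by case: (P _); rewrite addn1.
Qed.

(** The least [m] whose count exceeds [k] is the successor of the wanted element. *)
Lemma count_below_surj P k : (k < count_below P n)%N ->
  exists2 v : 'I_n, P v & count_below P v = k.
Proof.
move=> ltk; have ex : exists m, (k < count_below P m)%N by exists n.
case: (ex_minnP ex) => [[|m]]; first by rewrite count_below0.
move=> ltkm min; have ltmn : (m < n)%N by apply: min.
have lek : (count_below P m <= k)%N.
  by rewrite leqNgt; apply/negP => /min; rewrite ltnn.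
move: ltkm; rewrite (count_belowS _ (Ordinal ltmn)) /= => ltkm.
exists (Ordinal ltmn); first by case: (P _) ltkm => //; lia.
by apply/eqP; rewrite eqn_leq lek /=; case: (P _) ltkm; lia.
Qed.

Lemma card_ltn m : (m <= n)%N -> #|[set k : 'I_n | (k < m)%N]| = m.
Proof. exact: count_belowT. Qed.

Lemma card_ltnD1 (i : 'I_n) m : (i < m)%N -> (m <= n)%N ->
  #|[set k : 'I_n | (k < m)%N] :\ i| = m.-1.
Proof.
move=> ltim lemn; have := cardsD1 i [set k : 'I_n | (k < m)%N].
by rewrite inE ltim card_ltn // => {2}->.
Qed.

Lemma card_perm_ltn (s : 'S_n) m :
  (m <= n)%N -> #|[set k | (s k < m)%N]| = m.
Proof.
move=> lemn; rewrite -[RHS](card_ltn lemn) -(card_imset _ (@perm_inj _ s)).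
apply: eq_card => v; rewrite !inE; apply/imsetP/idP => [[k]|ltv].
  by rewrite inE => ? ->.
by exists (s^-1%g v); rewrite ?inE permKV.
Qed.

End Count.

(** * 321-avoiding permutations and their heights *)

Section Avoiding.
Variable n : nat.
Implicit Types s : 'S_n.

(** A decreasing pair of non-excedances extends to a 321 pattern on its left, one of excedances on
    its right. *)
Lemma avoids321P s :
  reflect (forall i j : 'I_n, (i < j)%N ->
             (i < s i)%N = (j < s j)%N -> (s i < s j)%N)
          (avoids321 s).
Proof.
apply: (iffP idP) => [av i j ltij eij | mono].
  have no (a b c : 'I_n) : (a < b)%N -> (b < c)%N -> (s b < s a)%N ->
      (s c < s b)%N -> False.
    move=> ab bc ba cb; move/forallP/(_ a)/forallP/(_ b)/forallP/(_ c): av.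
    by rewrite ab bc ba cb.
  rewrite ltnNge leq_eqVlt; apply/negP => /predU1P[e|ltji].
    by move/val_inj/perm_inj: e ltij => ->; rewrite ltnn.
  have [ei|ei] := ltnP i (s i); last first.
    (* otherwise [j] and the [i + 1] first positions all have values [<= s i <= i] *)
    have sub : j |: [set k : 'I_n | (k < i.+1)%N] \subset [set k | (s k < (s i).+1)%N].
      apply/subsetP => k; rewrite !inE !ltnS => /orP[/eqP->|]; first exact: ltnW.
      rewrite leq_eqVlt => /predU1P[/val_inj->//|ltki].
      by rewrite leqNgt; apply/negP => ltik; apply: (no k i j).
    have jN : j \notin [set k : 'I_n | (k < i.+1)%N] by rewrite inE ltnS -ltnNge.
    have := subset_leq_card sub; rewrite card_perm_ltn // cardsU1 jN.
    rewrite card_ltn //; lia.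
  have ej : (j < s j)%N by rewrite -eij.
  (* All values below [s j] sit at positions below [j] other than [i], which forces [s j < j]. *)
  have sub : [set k | (s k < s j)%N] \subset [set k : 'I_n | (k < j)%N] :\ i.
    apply/subsetP => k; rewrite !inE => ltkj; apply/andP; split.
      by apply/eqP => ki; move: ltkj; rewrite ki; lia.
    case: (ltngtP k j) => // [ltjk|/val_inj kj]; last by rewrite kj ltnn in ltkj.
    by case: (no i j k).
  have := subset_leq_card sub.
  rewrite card_perm_ltn ?card_ltnD1 ?(ltnW (ltn_ord _)) //; lia.
apply/forallP => i; apply/forallP => j; apply/forallP => k.
apply/negP => /and4P[ij jk ji kj].
(* Two of the three positions fall in the same class. *)
have := mono i j ij; have := mono j k jk; have := mono i k (ltn_trans ij jk).
by case: (i < s i)%N; case: (j < s j)%N; case: (k < s k)%N; lia.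
Qed.

Definition fixnum s : nat := #|[set i : 'I_n | s i == i]|.

Lemma derangement_fixnum s : derangement s = (fixnum s == 0%N).
Proof.
rewrite /fixnum cards_eq0; apply/forallP/eqP => [d | d i].
  by apply/setP => i; rewrite !inE (negPf (d i)).
by have := in_set0 i; rewrite -d inE => ->.
Qed.

(** The height before step [i]: the arcs from an excedance to its value that are open there. *)
Definition perm_height s (i : nat) := #|[set a : 'I_n | (a < i <= s a)%N]|.

Lemma perm_height0 s : perm_height s 0 = 0%N.
Proof. by apply: eq_card0 => a; rewrite inE ltn0. Qed.

Lemma perm_heightn s : perm_height s n = 0%N.
Proof. by apply: eq_card0 => a; rewrite inE [(n <= _)%N]leqNgt !ltn_ord. Qed.

(** Step [i] opens the arc starting at [i] and closes the one ending there, if any. Closings are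
    added on the left to avoid truncated subtraction. *)
Lemma perm_heightS s (i : 'I_n) :
  (perm_height s i.+1 + (s^-1%g i < i)%N = perm_height s i + (i < s i)%N)%N.
Proof.
rewrite /perm_height (cardsD1 i) [in RHS](cardsD1 (s^-1%g i)) !inE permKV !leqnn.
rewrite andbT /= addnC addnA addnAC; congr (_ + _)%N; congr (_ + _)%N.
apply: eq_card => a; rewrite !inE -(inj_eq (@perm_inj _ s) a) permKV -!val_eqE /=.
by lia.
Qed.

Lemma perm_height_gt0 s (i : 'I_n) : (s^-1%g i < i)%N -> (0 < perm_height s i)%N.
Proof.
by move=> lt; apply/card_gt0P; exists (s^-1%g i); rewrite inE permKV lt leqnn.
Qed.

Lemma exc_le_perm_height s (i : 'I_n) : ((i < s i)%N <= perm_height s i.+1)%N.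
Proof.
have := perm_heightS s i; have := @perm_height_gt0 s i.
by case: (i < s i)%N; case: (s^-1%g i < i)%N => //= gt0; lia.
Qed.

(** An arc over a fixed point [i] would leave fewer than [i] positions for the values below [i].
    Conversely, at height [0] the first [i] positions have values below [i], so [s i < i] would put
    [i.+1] positions into [i] values. *)
Lemma perm_height_fixed s (i : 'I_n) : avoids321 s ->
  (s i == i) = [&& ~~ (i < s i)%N, ~~ (s^-1%g i < i)%N & perm_height s i == 0%N].
Proof.
move/avoids321P => mono; apply/eqP/and3P => [fi | [ni _ h0]].
  have fi' : s^-1%g i = i by rewrite -[in LHS]fi permK.
  rewrite fi fi' ltnn; split=> //; apply: contraT; rewrite -lt0n => /card_gt0P[a].
  rewrite inE => /andP[lta lea].
  have sub : [set k | (s k < i)%N] \subset [set k : 'I_n | (k < i)%N] :\ a.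
    apply/subsetP => k; rewrite !inE => ltk; apply/andP; split.
      by apply/eqP => ka; move: ltk; rewrite ka; lia.
    case: (ltngtP k i) => // [ltik|/val_inj ki]; last by rewrite ki fi ltnn in ltk.
    by have := mono i k ltik; rewrite fi ltnn; lia.
  have := subset_leq_card sub.
  rewrite card_perm_ltn ?card_ltnD1 ?(ltnW (ltn_ord _)) //; lia.
apply: val_inj => /=; apply/eqP; rewrite eqn_leq leqNgt ni /= leqNgt.
apply/negP => lti.
have sub : [set k : 'I_n | (k < i.+1)%N] \subset [set k | (s k < i)%N].
  apply/subsetP => k; rewrite !inE ltnS leq_eqVlt => /predU1P[/val_inj->//|ltk].
  rewrite ltnNge; apply/negP => lek.
  suff : (0 < perm_height s i)%N by rewrite (eqP h0).
  by apply/card_gt0P; exists k; rewrite inE ltk.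
have := subset_leq_card sub.
by rewrite card_perm_ltn ?card_ltn ?(ltnW (ltn_ord _)) // ltnn.
Qed.

Lemma card_set_sum (T : finType) (P : pred T) : #|[set x | P x]| = (\sum_x P x)%N.
Proof. by rewrite -sum1dep_card big_mkcond. Qed.

Lemma card_interval a b : (b <= n)%N -> #|[set i : 'I_n | (a <= i < b)%N]| = (b - a)%N.
Proof.
move=> leb; have := cardsID [set i : 'I_n | (i < a)%N] [set i : 'I_n | (i < b)%N].
rewrite (card_ltn leb).
have -> : [set i : 'I_n | (i < b)%N] :\: [set i : 'I_n | (i < a)%N] =
    [set i : 'I_n | (a <= i < b)%N] by apply/setP => i; rewrite !inE -leqNgt.
have -> : [set i : 'I_n | (i < b)%N] :&: [set i : 'I_n | (i < a)%N] =
    [set i : 'I_n | (i < minn a b)%N].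
  by apply/setP => i; rewrite !inE ltn_min andbC.
rewrite card_ltn; first by lia.
by rewrite geq_min leb orbT.
Qed.

(** Double counting: an excedance [a] is open after the steps [i] with [a <= i < s a]; truncation
    makes the other positions contribute [0]. *)
Lemma sum_perm_height s :
  (\sum_(i < n) perm_height s i.+1 = \sum_(i < n) (s i - i))%N.
Proof.
under eq_bigr => i _ do rewrite /perm_height card_set_sum.
rewrite exchange_big /=; apply: eq_bigr => a _.
by rewrite -card_set_sum -card_interval // ltnW.
Qed.

(** Only an excedance [i] can be the left entry of an inversion. All earlier values are smaller than
    [s i], so [s i - i] smaller values remain on its right. *)
Lemma invnum_height s : avoids321 s ->
  invnum s = (\sum_(i < n) perm_height s i.+1)%N.
Proof.
move/avoids321P => mono; rewrite sum_perm_height /invnum card_set_sum.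
rewrite -(pair_bigA _ (fun i j : 'I_n => ((i < j)%N && (s j < s i)%N : nat))) /=.
apply: eq_bigr => i _; rewrite -card_set_sum; have [lti|lei] := ltnP i (s i).
  have := cardsID [set j : 'I_n | (j < i)%N] [set j | (s j < s i)%N].
  rewrite card_perm_ltn; last exact: ltnW.
  have -> : [set j | (s j < s i)%N] :&: [set j : 'I_n | (j < i)%N] = [set j : 'I_n | (j < i)%N].
    apply/setP => j; rewrite !inE andbC; case: (ltnP j i) => //= ltji.
    have := mono j i ltji; rewrite lti; case: (ltnP j (s j)) => [_ -> //|le _]; lia.
  have -> : [set j | (s j < s i)%N] :\: [set j : 'I_n | (j < i)%N] =
      [set j : 'I_n | (i < j)%N && (s j < s i)%N].
    apply/setP => j; rewrite !inE -leqNgt leq_eqVlt.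
    by case: eqP => [/val_inj->|] //=; rewrite ltnn andbF.
  rewrite card_ltn ?(ltnW (ltn_ord _)) // => e.
  by apply/eqP; rewrite -(eqn_add2l i) subnKC ?(ltnW lti) //; apply/eqP.
have -> : (s i - i = 0)%N by lia.
apply: eq_card0 => j; rewrite inE; apply/negP => /andP[ij ji].
have := mono i j ij; lia.
Qed.

(** * The bijection between 321-avoiding permutations and valid words *)

Definition perm_word s : n.-tuple (bool * bool) :=
  [tuple ((i < s i)%N, (s^-1%g i < i)%N) | i < n].

Lemma perm_wordE s i : tnth (perm_word s) i = ((i < s i)%N, (s^-1%g i < i)%N).
Proof. by rewrite tnth_mktuple. Qed.

Lemma height_perm_word s i : (i <= n)%N -> height_at (perm_word s) i = perm_height s i.
Proof.
elim: i => [|i IHi] lti; first by rewrite perm_height0 /height_at take0.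
have := height_atS (perm_word s) (Ordinal lti); rewrite perm_wordE /= => ->.
rewrite IHi; last exact: ltnW.
by rewrite /next_height -[X in (X + _ - _)%N]/(perm_height s (Ordinal lti)) -perm_heightS addnK.
Qed.

Lemma valid_perm_word s : valid_word (perm_word s).
Proof.
rewrite /valid_word height_perm_word // perm_heightn eqxx andbT.
apply/forallP => i; apply/implyP; rewrite perm_wordE /= => lt.
by rewrite height_perm_word ?perm_height_gt0 // ltnW.
Qed.

Section Weight.
Variables (R : comNzRingType) (y t q : R).

Lemma step_weight_perm s (i : 'I_n) : avoids321 s ->
  step_weight y t q ((i < s i)%N, (s^-1%g i < i)%N) (perm_height s i) =
  y ^+ (s i == i) * t ^+ (i < s i)%N * q ^+ (perm_height s i.+1 - (i < s i)%N).
Proof.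
move=> av; rewrite perm_height_fixed //.
have := perm_heightS s i; have := @perm_height_gt0 s i.
case: (i < s i)%N; case: (s^-1%g i < i)%N => /= gt0 e.
- case: (perm_height s i) gt0 e => [/(_ isT)//|h] _ e.
  by rewrite mul1r expr1; congr (_ * _ ^+ _); lia.
- by rewrite mul1r expr1; congr (_ * _ ^+ _); lia.
- case: (perm_height s i) gt0 e => [/(_ isT)//|h] _ e.
  by rewrite !mul1r; congr (_ ^+ _); lia.
have -> : perm_height s i.+1 = perm_height s i by lia.
by case: (perm_height s i) => [|h] /=; rewrite ?mulr1 ?mul1r ?subn0.
Qed.

Lemma word_weight_perm s : avoids321 s ->
  word_weight y t q 0 (perm_word s) =
  y ^+ fixnum s * t ^+ excnum s * q ^+ (invnum s - excnum s).
Proof.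
move=> av; rewrite word_weight_prod.
have -> : foldl next_height 0 (perm_word s) = 0%N.
  rewrite -(perm_heightn s) -height_perm_word // /height_at take_oversize //.
  by rewrite size_tuple.
rewrite eqxx mulr1 -(big_mkord predT (fun i =>
  step_weight y t q (nth (false, false) (perm_word s) i) (height_at (perm_word s) i))).
rewrite size_tuple big_mkord.
under eq_bigr => i _ do
  rewrite -tnth_nth perm_wordE height_perm_word ?(ltnW (ltn_ord i)) // step_weight_perm //.
rewrite !big_split /= -!expr_sum /fixnum /excnum !card_set_sum; congr (_ * _ ^+ _).
(* Truncated subtraction commutes with the sum, as each excedance is itself counted in the height
   after it. *)
by rewrite invnum_height // sumnB // => i _; apply: exc_le_perm_height.
Qed.

End Weight.

(** Positions of one class are mapped increasingly onto the values of that class, so ranks are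
    preserved. *)
Lemma count_below_avoids s (i : 'I_n) : avoids321 s ->
  count_below (fun v : 'I_n => (s^-1%g v < v)%N == (i < s i)%N) (s i) =
  count_below (fun j : 'I_n => (j < s j)%N == (i < s i)%N) i.
Proof.
move/avoids321P => mono; rewrite /count_below -[RHS](card_imset _ (@perm_inj _ s)).
apply: eq_card => v; rewrite inE -{1 2 4}(permKV s v) permK mem_imset; last exact: perm_inj.
rewrite inE permKV; set j := s^-1%g v.
have -> : v = s j by rewrite permKV.
case: eqP => //= eji; case: (ltngtP j i) => [/mono|/mono|/val_inj->]; last by rewrite ltnn.
  exact.
by move/(_ (esym eji)) => lt; apply/negbTE; rewrite -leqNgt ltnW.
Qed.

(** The word determines the class of [s i] and its rank there, hence [s i]. *)
Lemma perm_word_inj : {in [set s | avoids321 s] &, injective perm_word}.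
Proof.
move=> s s'; rewrite !inE => av av' e.
have [e1 e2] : (forall i : 'I_n, (i < s i)%N = (i < s' i)%N) /\
    (forall i : 'I_n, (s^-1%g i < i)%N = (s'^-1%g i < i)%N).
  split=> i; have := congr1 (fun w => tnth w i) e; rewrite !perm_wordE.
    by case.
  by case.
apply/permP => i; pose P (v : 'I_n) := (s^-1%g v < v)%N == (i < s i)%N.
apply: (@count_below_inj _ P); rewrite /P ?permK ?e2 ?permK ?e1 //.
rewrite -/P -e1 /P count_below_avoids //.
under [RHS]eq_count_below => v do rewrite e2 e1.
rewrite count_below_avoids // -e1.
by apply: eq_count_below => j; rewrite e1.
Qed.

Lemma count_below_valid (w : n.-tuple (bool * bool)) i :
  valid_word w -> (i <= n)%N ->
  count_below (fun v => (tnth w v).1) i =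
  (count_below (fun v => (tnth w v).2) i + height_at w i)%N.
Proof.
case/andP=> /forallP pos _; elim: i => [|i IHi] lti.
  by rewrite !count_below0 /height_at take0.
have := height_atS w (Ordinal lti) => /= ->.
rewrite !(count_belowS _ (Ordinal lti)) IHi ?(ltnW lti) // /next_height.
have := implyP (pos (Ordinal lti)).
by case: (tnth w _) => [[] []] //= => [/(_ isT)||/(_ isT)|]; lia.
Qed.

(** Each position is sent to the value of the same class and rank; this is possible because final
    height [0] makes the position and value classes equally large. *)
Lemma perm_word_surj (w : n.-tuple (bool * bool)) : valid_word w ->
  exists2 s : 'S_n, avoids321 s & perm_word s = w.
Proof.
move=> vw; pose a v := (tnth w v).1; pose b v := (tnth w v).2.
have cab i : (i <= n)%N -> count_below a i = (count_below b i + height_at w i)%N.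
  exact: count_below_valid.
have [/forallP pos /eqP hn0] := andP vw.
(* The excedance value of a given rank comes strictly after the excedance position of that rank. *)
have lt_ba (i : 'I_n) : (count_below b i.+1 <= count_below a i)%N.
  rewrite count_belowS cab ?(ltnW (ltn_ord i)) // leq_add2l.
  by have := implyP (pos i); rewrite /b; case: (tnth w i).2 => //; apply.
have cE (c : pred 'I_n) e m : (m <= n)%N -> count_below (fun v => c v == e) m =
    (if e then count_below c m else m - count_below c m)%N.
  move=> lem; case: e.
    by apply: eq_count_below => v; case: (c v).
  have := count_belowC c lem.
  have -> : count_below (predC c) m = count_below (fun v => c v == false) m.
    by apply: eq_count_below => v /=; case: (c v).
  lia.
have ex (i : 'I_n) : exists v, (b v == a i) &&
    (count_below (fun u => b u == a i) v == count_below (fun u => a u == a i) i).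
  have [|v bv cv] := @count_below_surj _ (fun u => b u == a i)
     (count_below (fun u => a u == a i) i); last by exists v; rewrite bv cv eqxx.
  have := @ltn_count_below _ (fun u => a u == a i) i n (eqxx _) (ltn_ord i).
  by rewrite !(cE _ _ n) // cab // hn0 addn0.
pose f i := xchoose (ex i).
have bf i : b (f i) = a i by have /andP[/eqP] := xchooseP (ex i).
have cf i : count_below (fun u => b u == a i) (f i) = count_below (fun u => a u == a i) i.
  by have /andP[_ /eqP] := xchooseP (ex i).
have finj : injective f.
  move=> i j eij; have aij : a i = a j by rewrite -!bf eij.
  apply: (@count_below_inj _ (fun u => a u == a i)); rewrite ?aij //.
  by rewrite -cf -[in LHS]aij -cf eij aij.
pose s := perm finj.
have sE i : s i = f i by rewrite permE.
have exc (i : 'I_n) : (i < s i)%N = a i.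
  have := cf i; rewrite sE !cE ?(ltnW (ltn_ord _)) //.
  have := lt_ba i; case: (boolP (a i)) => ai le cfi; [apply: contraT | apply/negbTE/negP].
    rewrite -leqNgt => lefi.
    have := @ltn_count_below _ b (f i) i.+1; rewrite bf ai ltnS => /(_ isT lefi); lia.
  move=> ltfi.
  (* At least [i.+1 - count_below a i] indices up to [i] lie outside [b], but only
     [i - count_below a i] such indices precede [f i]. *)
  have := leq_count_below (predC b) ltfi.
  have := count_belowC b (ltn_ord i); have := count_belowC b (ltnW (ltn_ord (f i))).
  have := count_belowC a (ltnW (ltn_ord i)); lia.
exists s.
  apply/avoids321P => i j ltij; rewrite !exc => aij; rewrite !sE.
  have := @ltn_count_below _ (fun u => a u == a i) i j (eqxx _) ltij.
  rewrite -cf [in X in (_ < X)%N]aij -cf -aij => ltc.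
  rewrite ltnNge; apply/negP => /(leq_count_below (fun u => b u == a i)); lia.
apply: eq_from_tnth => i; rewrite perm_wordE exc.
have -> : (s^-1%g i < i)%N = b i.
  by have := exc (s^-1%g i); rewrite permKV -bf -sE permKV.
by rewrite /a /b; case: (tnth w i).
Qed.

Lemma sum_avoids321 (R : comNzRingType) (y t q : R) :
  \sum_(s : 'S_n | avoids321 s)
     y ^+ fixnum s * t ^+ excnum s * q ^+ (invnum s - excnum s) =
  motzkin (fun h => t * q ^+ h)
          (fun h => if h is k.+1 then t * q ^+ k + q ^+ h else y)
          (fun h => q ^+ h) n 0.
Proof.
rewrite -sum_word_weight (bigID (@valid_word n)) /= [X in _ + X]big1 ?addr0; last first.
  by move=> w; apply: word_weight0.
have -> : \sum_(w : n.-tuple (bool * bool) | valid_word w) word_weight y t q 0 w =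
    \sum_(w in [set perm_word s | s in [set s | avoids321 s]]) word_weight y t q 0 w.
  apply: eq_bigl => w; apply/idP/imsetP => [/perm_word_surj[s av <-]|[s _ ->]].
    by exists s; rewrite ?inE.
  exact: valid_perm_word.
rewrite big_imset /=; last exact: perm_word_inj.
by apply: eq_big => [s | s av]; rewrite ?inE ?word_weight_perm.
Qed.

Lemma excnum_le_invnum s : avoids321 s -> (excnum s <= invnum s)%N.
Proof.
move=> av; rewrite invnum_height // /excnum card_set_sum; apply: leq_sum => i _.
exact: exc_le_perm_height.
Qed.

End Avoiding.

Theorem theorem1p4 (R : comNzRingType) (q : R) (n : nat) (hn : (1 <= n)%N) :
  [/\ Ctq (-1) q n
        = \sum_(s : 'S_n | avoids321 s) (-1) ^+ excnum s * q ^+ (invnum s - excnum s),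
      \sum_(s : 'S_n | avoids321 s) (-1) ^+ excnum s * q ^+ (invnum s - excnum s)
        = (if odd n then (- q) ^+ (n.-1)./2 * Carlitz (q ^+ 2) (n.-1)./2 else 0)
    & \sum_(s : 'S_n | avoids321 s && derangement s) (-1) ^+ excnum s * q ^+ invnum s
        = (if odd n then 0 else (- q) ^+ n./2 * Carlitz (q ^+ 2) n./2)].
Proof.
have C : Ctq (-1) q n =
    \sum_(s : 'S_n | avoids321 s) (-1) ^+ excnum s * q ^+ (invnum s - excnum s).
  rewrite Ctq_motzkin -(sum_avoids321 n 1 (-1) q); apply: eq_bigr => s _.
  by rewrite expr1n mul1r.
split=> //; first by rewrite -C Ctq_Nm1.
(* [y = 0] keeps the derangements, as 0^0 = 1, and [t = - q] supplies the factor [q ^+ excnum s]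
   missing from the third one. *)
transitivity (\sum_(s : 'S_n | avoids321 s)
    0 ^+ fixnum s * (- q) ^+ excnum s * q ^+ (invnum s - excnum s)).
  rewrite big_mkcondr; apply: eq_bigr => s av; rewrite derangement_fixnum expr0n.
  case: eqP => _; last by rewrite !mul0r.
  rewrite mul1r -[- q]mulN1r exprMn -mulrA -exprD subnKC //.
  exact: excnum_le_invnum.
(* The level weight at height k+1 is now -q q^k + q^(k+1) = 0, and on the axis it is [y = 0]. *)
rewrite sum_avoids321 motzkin_normalise big_ord0 mul1r -dyck_signed.
apply: eq_motzkin => // h.
  by rewrite mulNr -exprS mulNr -exprD; congr (- q ^+ _); lia.
by case: h => // h; rewrite exprS; ring.
Qed.
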